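(* For every matrix $X\in\mathbb{R}^{m\times n}$ there exists accordingly a number $\varepsilon^*>0$ such that $\operatorname{rank}(X)=\lceil\phi_\varepsilon(X)\rceil$ for all $\varepsilon\in(0,\varepsilon^*]$.
   Context: For $\varepsilon>0$ the function $\phi_\varepsilon:\mathbb{R}^{m\times n}\to\mathbb{R}$ is defined by $\phi_\varepsilon(X)=\operatorname{tr}\left(X(X^TX+\varepsilon I)^{-1}X^T\right)$, with $I$ the $n\times n$ identity matrix. $\lceil\cdot\rceil$ is the ceiling function. *)

(* Defs.v *)
From mathcomp Require Import all_boot all_order all_algebra.
From mathcomp Require Import reals.

Set Implicit Arguments.
Unset Strict Implicit.
Unset Printing Implicit Defensive.

Import GRing.Theory Num.Theory.
Local Open Scope ring_scope.

(* For 0 < eps the matrix X^T *m X + eps%:M is positive definite, so invmx is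
   a genuine inverse there; phi is only meant to be used for such eps. *)
Definition phi (R : realType) (m n : nat) (eps : R) (X : 'M[R]_(m, n)) : R :=
  \tr (X *m invmx (X^T *m X + eps%:M) *m X^T).

(* Main.v *)
(* Write X = C B with C of full column rank and B of full row rank r, and put
   G = C^T C and K = (B B^T)^-1.  Pushing B through the inverse gives
   phi_eps(X) = tr ((G + eps K)^-1 G) = r - eps tr ((G + eps K)^-1 K).
   Since G and K are positive definite, 0 <= tr ((G + eps K)^-1 K) <= tr (G^-1 K),
   so r - 1 < phi_eps(X) <= r as soon as eps tr (G^-1 K) < 1. *)
Require Import Defs.
From mathcomp Require Import all_boot all_order all_algebra.
From mathcomp Require Import reals.

Local Open Scope ring_scope.

Import Order.TTheory GRing.Theory Num.Theory.

Section PositiveSemidefinite.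
Context {R : rcfType}.

(** Encoded by a Gram factor rather than a quadratic form, so closure properties and trace bounds
    follow by computing with factors. The height [k] is left free so that factors can be stacked. *)
Definition psd {n : nat} (S : 'M[R]_n) : Prop :=
  exists k (Z : 'M[R]_(k, n)), S = Z^T *m Z.

Lemma psd_gram {k n} (Z : 'M[R]_(k, n)) : psd (Z^T *m Z).
Proof. by exists k, Z. Qed.

Lemma psd_sym {n} (S : 'M[R]_n) : psd S -> S^T = S.
Proof. by case=> k [Z ->]; rewrite trmx_mul trmxK. Qed.

Lemma psdD {n} (S T : 'M[R]_n) : psd S -> psd T -> psd (S + T).
Proof.
move=> [k [Z ->]] [l [W ->]]; exists (k + l)%N, (col_mx Z W).
by rewrite tr_col_mx mul_row_col.
Qed.

Lemma psdZ {n} (a : R) (S : 'M[R]_n) : 0 <= a -> psd S -> psd (a *: S).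
Proof.
move=> a0 [k [Z ->]]; exists k, (Num.sqrt a *: Z).
by rewrite -scalemxAr linearZ /= -scalemxAl scalerA -expr2 sqr_sqrtr.
Qed.

Lemma psd_congr {n p} (Q : 'M[R]_(n, p)) (S : 'M[R]_n) :
  psd S -> psd (Q^T *m S *m Q).
Proof.
by move=> [k [Z ->]]; exists k, (Z *m Q); rewrite trmx_mul !mulmxA.
Qed.

(** By symmetry, S^-1 = (S^-1)^T S S^-1 is a congruence of S. *)
Lemma psd_inv {n} (S : 'M[R]_n) : S \in unitmx -> psd S -> psd (invmx S).
Proof.
move=> uS pS; have := psd_congr (invmx S) S pS.
by rewrite trmx_inv (psd_sym _ pS) mulVmx // mul1mx.
Qed.

Lemma mxtrace_gram_sum {k n} (Z : 'M[R]_(k, n)) :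
  \tr (Z^T *m Z) = \sum_i \sum_j Z j i ^+ 2.
Proof.
apply: eq_bigr => i _; rewrite mxE; apply: eq_bigr => j _.
by rewrite mxE expr2.
Qed.

Lemma mxtrace_gram_ge0 {k n} (Z : 'M[R]_(k, n)) : 0 <= \tr (Z^T *m Z).
Proof.
by rewrite mxtrace_gram_sum; do 2 (apply: sumr_ge0 => ? _); apply: sqr_ge0.
Qed.

Lemma mxtrace_gram_eq0 {k n} (Z : 'M[R]_(k, n)) : \tr (Z^T *m Z) = 0 -> Z = 0.
Proof.
rewrite mxtrace_gram_sum => h; apply/matrixP => j i; rewrite mxE.
have h1 := psumr_eq0P (fun i _ => sumr_ge0 _ (fun j _ => sqr_ge0 (Z j i))) h.
have h2 := psumr_eq0P (fun j _ => sqr_ge0 (Z j i)) (h1 i isT).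
by apply/eqP; rewrite -sqrf_eq0 h2.
Qed.

(** By cyclicity, tr (Z^T Z W^T W) is the squared Frobenius norm of Z W^T. *)
Lemma mxtrace_psd_mul_ge0 {n} (S T : 'M[R]_n) :
  psd S -> psd T -> 0 <= \tr (S *m T).
Proof.
move=> [k [Z ->]] [l [W ->]]; rewrite mulmxA mxtrace_mulC.
have -> : W *m (Z^T *m Z *m W^T) = (Z *m W^T)^T *m (Z *m W^T).
  by rewrite trmx_mul trmxK !mulmxA.
exact: mxtrace_gram_ge0.
Qed.

(** If V Z^T Z = 0, then Z V^T has Frobenius norm 0, so V Z^T = 0, and V = 0 because Z^T has
    independent rows. *)
Lemma gram_unitmx {k n} (Z : 'M[R]_(k, n)) :
  row_full Z -> (Z^T *m Z) \in unitmx.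
Proof.
move=> fZ; rewrite -row_free_unit -kermx_eq0; apply/eqP.
set V := kermx _; have V0 : V *m (Z^T *m Z) = 0 by apply: mulmx_ker.
have : Z *m V^T = 0.
  apply: mxtrace_gram_eq0.
  by rewrite trmx_mul trmxK !mulmxA -(mulmxA V) V0 mul0mx mxtrace0.
move/(congr1 trmx); rewrite trmx_mul trmxK trmx0 => VZ0.
apply: (@row_free_inj _ _ _ _ Z^T); last by rewrite VZ0 mul0mx.
by rewrite /row_free mxrank_tr.
Qed.

(** With S = W^T W, the sum is the Gram matrix of Z stacked on W, whose row space is already full
    thanks to Z. *)
Lemma gram_add_psd_unitmx {k n} (Z : 'M[R]_(k, n)) (S : 'M[R]_n) :
  row_full Z -> psd S -> (Z^T *m Z + S) \in unitmx.
Proof.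
move=> fZ [l [W ->]]; rewrite -mul_row_col -tr_col_mx; apply: gram_unitmx.
rewrite -sub1mx -addsmxE; apply: submx_trans (addsmxSl Z W).
by rewrite sub1mx.
Qed.

(** Inversion is antitone: with F = S + T, the difference is the congruence by F^-1 of F S^-1 F - F
    = T + T S^-1 T. *)
Lemma invmx_sub_psd {n} (S T : 'M[R]_n) :
  S \in unitmx -> S + T \in unitmx -> psd S -> psd T ->
  psd (invmx S - invmx (S + T)).
Proof.
move=> uS uF pS pT; set F := S + T in uF *.
have sT := psd_sym _ pT; have sF : (invmx F)^T = invmx F.
  by rewrite trmx_inv linearD /= (psd_sym _ pS) sT.
have := psd_congr (invmx F) _ (psdD _ _ pT (psd_congr T _ (psd_inv _ uS pS))).
have -> : T + T^T *m invmx S *m T = F *m invmx S *m F - F.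
  rewrite sT /F !(mulmxDl, mulmxDr) mulmxV // mul1mx -(mulmxA T _ S) mulVmx //.
  by rewrite mulmx1 mul1mx [S + T + _]addrC addrK.
rewrite sF mulmxBr mulmxBl mulVmx // mul1mx !mulmxA mulVmx // mul1mx.
by rewrite -mulmxA mulmxV // mulmx1.
Qed.

End PositiveSemidefinite.

Lemma phi_factor {R : realType} {m n r : nat} (C : 'M[R]_(m, r))
    (B : 'M[R]_(r, n)) (eps : R) :
  row_full C -> row_free B -> 0 < eps ->
  let K := invmx (B *m B^T) in
  phi eps (C *m B) = r%:R - eps * \tr (invmx (C^T *m C + eps *: K) *m K).
Proof.
move=> fC fB eps0 K; set G := C^T *m C; set F := G + _.
have uH : B *m B^T \in unitmx.
  by rewrite -{1}(trmxK B); apply: gram_unitmx; rewrite /row_full mxrank_tr.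
have pK : psd K.
  by apply: psd_inv => //; rewrite -{1}(trmxK B); apply: psd_gram.
have uF : F \in unitmx.
  by apply: gram_add_psd_unitmx => //; apply: psdZ => //; apply: ltW.
have uA : (C *m B)^T *m (C *m B) + eps%:M \in unitmx.
  (* Here X^T X may be singular, so the full-rank Gram term is eps I, with factor sqrt(eps) I. *)
  rewrite addrC -(sqr_sqrtr (ltW eps0)) expr2 scalar_mxM -{1}tr_scalar_mx.
  apply: gram_add_psd_unitmx (psd_gram _).
  by rewrite row_full_unit unitmxE det_scalar unitrX // unitfE sqrtr_eq0 -ltNge.
(* The term eps B is rewritten as B B^T (eps K) B, so that B B^T factors out on the left. *)
have push : B *m ((C *m B)^T *m (C *m B) + eps%:M) = B *m B^T *m F *m B.
  rewrite /F !mulmxDr mulmxDl trmx_mul -!mulmxA; congr (_ + _).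
  by rewrite mul_mx_scalar -scalemxAl -!scalemxAr !mulmxA mulmxV // mul1mx.
have Binv : B *m invmx ((C *m B)^T *m (C *m B) + eps%:M) = invmx F *m K *m B.
  rewrite -[RHS](mulmxK uA) -[_ *m K *m B *m _]mulmxA push.
  by rewrite -(mulmxA (B *m B^T)) (mulmxA (_ *m K)) mulmxKV // mulKmx.
rewrite /phi -(mulmxA C) Binv trmx_mul mxtrace_mulC.
have -> : B^T *m C^T *m (C *m (invmx F *m K *m B))
        = B^T *m (G *m invmx F *m K *m B) by rewrite !mulmxA.
rewrite mxtrace_mulC -!mulmxA mulVmx // mulmx1.
(* The trace is now tr (G F^-1), and G F^-1 = I - eps K F^-1. *)
rewrite mulmxA -/G (_ : G = F - eps *: K); last by rewrite addrK.
by rewrite mulmxBl mulmxV // linearB /= mxtrace1 -scalemxAl mxtraceZ mxtrace_mulC.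
Qed.

Theorem corollary2p2 (R : realType) (m n : nat) (X : 'M[R]_(m, n)) :
  exists eps_star : R, 0 < eps_star /\
    forall eps : R, 0 < eps -> eps <= eps_star ->
      (\rank X)%:Z = Num.ceil (phi eps X).
Proof.
pose C := col_base X; pose B := row_base X.
pose G := C^T *m C; pose K := invmx (B *m B^T); pose t := \tr (invmx G *m K).
have fC : row_full C by apply: col_base_full.
have fB : row_free B by apply: row_base_free.
have uG : G \in unitmx by apply: gram_unitmx.
have pG : psd G by apply: psd_gram.
have pK : psd K.
  rewrite /K -{1}(trmxK B); apply: psd_inv; last exact: psd_gram.
  by apply: gram_unitmx; rewrite /row_full mxrank_tr.
have t0 : 0 <= t by apply: mxtrace_psd_mul_ge0 => //; apply: psd_inv.
have t1 : 0 < 1 + t by rewrite ltr_pwDl.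
(* Using 1 + t instead of t covers t = 0 (as for X = 0) and gives the strict bound eps t < eps (1 +
   t) <= 1. *)
exists (1 + t)^-1; split=> [|eps eps0 le_eps]; first by rewrite invr_gt0.
have pE : psd (eps *: K) by apply: psdZ => //; apply: ltW.
have uF : G + eps *: K \in unitmx by apply: gram_add_psd_unitmx.
have ge0 : 0 <= \tr (invmx (G + eps *: K) *m K).
  by apply: mxtrace_psd_mul_ge0 => //; apply: psd_inv => //; apply: psdD.
have le_t : \tr (invmx (G + eps *: K) *m K) <= t.
  rewrite -subr_ge0 -linearB /= -mulmxBl.
  by apply: mxtrace_psd_mul_ge0 => //; apply: invmx_sub_psd.
have lt1 : eps * \tr (invmx (G + eps *: K) *m K) < 1.
  apply: le_lt_trans (_ : eps * t < 1).
    by rewrite ler_pM2l.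
  apply: lt_le_trans (_ : eps * (1 + t) <= 1); first by rewrite ltr_pM2l // ltrDr.
  by rewrite -ler_pdivlMr // mul1r.
have -> : phi eps X = phi eps (C *m B) by rewrite mulmx_base.
(* The ceiling is r exactly when r - 1 < phi <= r: [lt1] gives the left bound, [ge0] the right
   one. *)
apply/esym/ceil_def; rewrite phi_factor // -/G -/K.
rewrite rmorphB /= rmorph1 -pmulrn ltrD2l ltrN2 lt1 /= gerBl.
by rewrite mulr_ge0 // ltW.
Qed.
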